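(* For the binary Asian option with payoff function $f(x)=\mathbf 1\{x>K\}$, the conditional Malliavin (CMV) estimates $\mathbb E_{\mathbb Q}[\hat\theta_d\mid\boldsymbol Z]$ of delta, gamma and vega are given respectively by $$G_{\Delta,1}(K;\boldsymbol Z)=\Big(\frac{2e^{-rT}\tilde S_d}{TS_0\tilde S_A\sigma^2}-\frac{2e^{-rT}\omega}{S_0\sigma^2}\Big)\Phi_1-\frac{2e^{-rT-rt_1+\sigma^2t_1}}{T\tilde S_A\sigma^2}\Phi_2;$$ $$G_{\Gamma,1}(K;\boldsymbol Z)=\frac{4e^{-rT}}{\sigma^4S_0^2T^2}\Bigg[\Big(\frac{\tilde S_d^2}{\tilde S_A^2}+\omega rT^2-\frac{2rT\tilde S_d}{\tilde S_A}\Big)\Phi_1+\frac{S_0^2}{\tilde S_A^2}e^{-2rt_1+3\sigma^2t_1}\Phi_3+\Big(\frac{2\omega TS_0}{\tilde S_A}-\frac{2S_0\tilde S_d}{\tilde S_A^2}\Big)e^{-rt_1+\sigma^2t_1}\Phi_2\Bigg];$$ $$\begin{aligned}G_{\vartheta,1}(K;\boldsymbol Z)=&\ \Phi_1\Bigg(\frac{2e^{-rT}(\tilde S_d-(r-\sigma^2)T\tilde S_A)}{\sigma^2T\tilde S_A^2d}\sum_{j=1}^d\tilde S_j(\boldsymbol A_{j-1}\boldsymbol Z-\sigma t_j)-\frac{2e^{-rT}}{d^2\tilde S_A^2}\sum_{i=1}^d\sum_{j=i}^d\tilde S_i\tilde S_j(\boldsymbol A_{j-1}\boldsymbol Z-\sigma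 t_j)-\frac{e^{-rT}}{\sigma}\Bigg)\\&+\Phi_2\Bigg(\frac{2e^{-rT}S_0\sqrt{t_1}}{\sigma^2T\tilde S_A}\sigma\sqrt{t_1}e^{\sigma^2t_1/2-\omega t_1}-\frac{2S_0e^{-rT}}{\sigma^2Td\tilde S_A^2}e^{-rt_1+\sigma^2t_1}\sum_{j=1}^d\tilde S_j(\boldsymbol A_{j-1}\boldsymbol Z-\sigma t_j)\Bigg)\\&+\frac{1}{\sqrt{2\pi}}e^{-\psi_d^2/2}\Bigg(\frac{2e^{-rT}\tilde S_d\sqrt{t_1}}{\sigma^2T\tilde S_A}-\frac{2e^{-rT}}{\sigma^2}\sqrt{t_1}(r-\sigma^2)-\frac{2e^{-rT}\sqrt{t_1}}{\tilde S_A^2d^2}\sum_{i=1}^d\sum_{j=i}^d\tilde S_i\tilde S_j\Bigg)\\&-\frac{2e^{-rT}S_0\sqrt{t_1}}{\sigma^2T\tilde S_A}\frac{1}{\sqrt{2\pi}}e^{\sigma^2t_1/2-\omega t_1}e^{-(\psi_d+\sigma\sqrt{t_1})^2/2},\end{aligned}$$ where $\Phi_1:=\Phi(-\psi_d)$, $\Phi_2:=\Phi(-\sigma\sqrt{t_1}-\psi_d)$, $\Phi_3:=\Phi(-2\sigma\sqrt{t_1}-\psi_d)$.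
   Context: One-asset Black–Scholes model under the risk-neutral measure $\mathbb Q$: $S_t=S_0\exp(\omega t+\sigma\tilde W_t)$, $0\le t\le T$, with $S_0>0$, $r>0$, $\sigma>0$, $\omega=r-\frac12\sigma^2$, $\tilde W$ a standard Brownian motion under $\mathbb Q$. Let $K>0$ be the strike, $d\ge2$, $t_j=jT/d$, $S_j=S_{t_j}$, $S_A=\frac1d\sum_{j=1}^dS_j$. For a payoff function $f$, the simulation estimates $\hat\theta_d$ of the Greeks are $\hat\theta_d=e^{-rT}f(S_A)\,\mathrm{weight}(S_A,S_d,y,z)$ with $y=\frac Td\sum_{j=1}^dS_j(\tilde W_{t_j}-\sigma t_j)$, $z=\frac{T^2}{d^2}\sum_{i=1}^d\sum_{j=i}^dS_iS_j(\tilde W_{t_j}-\sigma t_j)$ and - delta: $\mathrm{weight}(x,s,y,z)=\frac{2}{S_0\sigma^2}\big(\frac{s-S_0}{Tx}-\omega\big)$; - gamma: $\mathrm{weight}(x,s,y,z)=\frac{4}{\sigma^4S_0^2T^2x^2}\big(s^2-2sS_0+S_0^2+\omega rT^2x^2-2rTsx+2\omega TS_0x\big)$; - vega: $\mathrm{weight}(x,s,y,z)=\frac{2}{\sigma^2T^2x^2}\big((s-S_0-(r-\sigma^2)Tx)y-\sigma^2z-\frac{\sigma T^2}{2}x^2\big)$. Generation of the path: $\tilde W_{t_1}=\sqrt{t_1}X_1$ and $(\tilde W_{t_2}-\tilde W_{t_1},\dots,\tilde W_{t_d}-\tilde W_{t_1})'=\boldsymbol A\boldsymbol Z$, where $X_1\sim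 N(0,1)$ and $\boldsymbol Z=(X_2,\dots,X_d)'\sim N(\boldsymbol 0_{d-1},\boldsymbol I_{d-1})$ are independent under $\mathbb Q$, and $\boldsymbol A$ is a $(d-1)\times(d-1)$ real matrix with $\boldsymbol A\boldsymbol A'=\boldsymbol\Sigma$, $\boldsymbol\Sigma_{ij}=t_{\min(i,j)+1}-t_1$. $\boldsymbol A_j$ is the $j$-th row of $\boldsymbol A$ and $\boldsymbol A_0=\boldsymbol 0_{d-1}'$. Set $\tilde S_j=S_0\exp(\omega(t_j-t_1)+\sigma\boldsymbol A_{j-1}\boldsymbol Z)$, so that $S_j=\exp(\omega t_1+\sigma\sqrt{t_1}X_1)\tilde S_j$; $\tilde S_A=\frac1d\sum_{j=1}^d\tilde S_j$; and $\psi_d=\frac{\ln K-\ln\tilde S_A-\omega t_1}{\sigma\sqrt{t_1}}$. $\Phi$ is the standard normal distribution function. *)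

(* Defs.v *)
From HB Require Import structures.
From mathcomp Require Import all_boot all_order all_algebra.
From mathcomp Require Import all_classical all_reals all_analysis.
Set Implicit Arguments.
Unset Strict Implicit.
Unset Printing Implicit Defensive.
Import Order.TTheory GRing.Theory Num.Theory.
Import numFieldNormedType.Exports.
Local Open Scope classical_set_scope.
Local Open Scope ring_scope.

Section probability_notions.
Context {dsp : measure_display} {Omega : measurableType dsp} {R : realType}.
Variable P : probability Omega R.

(* The law of X is N(m, v).  To be used for v > 0 only: normal_prob takes the
   standard deviation, and normal_prob m 0 is not the Dirac mass at m. *)
Definition normal_law (m v : R) (X : Omega -> R) : Prop :=
  forall B : set R, measurable B ->
    P (X @^-1` B) = normal_prob m (Num.sqrt v) B.

(* Subfamilies are covered by taking some of the B i to be setT. *)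
Definition mutually_independent (n : nat) (X : 'I_n -> Omega -> R) : Prop :=
  forall B : 'I_n -> set R, (forall i, measurable (B i)) ->
    P [set w | forall i, B i (X i w)] = (\prod_(i < n) P (X i @^-1` B i))%E.

Definition independent_pair (d1 d2 : measure_display) (T1 : measurableType d1)
    (T2 : measurableType d2) (X : Omega -> T1) (Y : Omega -> T2) : Prop :=
  forall (B : set T1) (C : set T2), measurable B -> measurable C ->
    P (X @^-1` B `&` Y @^-1` C) = (P (X @^-1` B) * P (Y @^-1` C))%E.

(* N(0, I_n) *)
Definition std_normal_vector (n : nat) (Z : Omega -> n.-tuple R) : Prop :=
  (forall i : 'I_n, normal_law 0 1 (fun w => tnth (Z w) i)) /\
  mutually_independent (fun (i : 'I_n) w => tnth (Z w) i).

Definition brownian_motion (T : R) (W : R -> Omega -> R) : Prop :=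
  [/\ forall t, 0 <= t <= T -> measurable_fun setT (W t),
      {ae P, forall w, W 0 w = 0},
      forall (n : nat) (t : nat -> R),
        0 <= t 0%N -> (forall k, (k < n)%N -> t k < t k.+1) -> t n <= T ->
        mutually_independent (fun (k : 'I_n) w => W (t k.+1) w - W (t k) w),
      forall s t, 0 <= s -> s < t -> t <= T ->
        normal_law 0 (t - s) (fun w => W t w - W s w) &
      {ae P, forall w, {within `[0, T], continuous (fun t => W t w)}}].

(* Y is a version of the conditional expectation of X given the
   sub-sigma-algebra G; the integrability of X, without which E[X | G] is not
   defined, is part of the assertion. *)
Definition is_cond_exp (G : set (set Omega)) (X Y : Omega -> R) : Prop :=
  [/\ P.-integrable setT (EFin \o X),
      P.-integrable setT (EFin \o Y),
      forall B : set R, measurable B -> G (Y @^-1` B) &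
      forall E, G E ->
        (\int[P]_(w in E) (X w)%:E = \int[P]_(w in E) (Y w)%:E)%E].

End probability_notions.

Section black_scholes.
Context {R : realType}.
Variables (S0 r sigma T : R).

Definition omega : R := r - sigma ^+ 2 / 2.

(* Arguments of the weights: x = S_A, s = S_d, and the statistics y, z. *)
Definition weight_delta (x s y z : R) : R :=
  2 / (S0 * sigma ^+ 2) * ((s - S0) / (T * x) - omega).

Definition weight_gamma (x s y z : R) : R :=
  4 / (sigma ^+ 4 * S0 ^+ 2 * T ^+ 2 * x ^+ 2) *
  (s ^+ 2 - 2 * s * S0 + S0 ^+ 2 + omega * r * T ^+ 2 * x ^+ 2
   - 2 * r * T * s * x + 2 * omega * T * S0 * x).

Definition weight_vega (x s y z : R) : R :=
  2 / (sigma ^+ 2 * T ^+ 2 * x ^+ 2) *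
  ((s - S0 - (r - sigma ^+ 2) * T * x) * y - sigma ^+ 2 * z
   - sigma * T ^+ 2 / 2 * x ^+ 2).

Variable d : nat.

Definition tgrid (j : nat) : R := j%:R * T / d%:R.

Section estimators.
Variables (Omega : Type) (W : R -> Omega -> R).

Definition price (t : R) (w : Omega) : R :=
  S0 * expR (omega * t + sigma * W t w).

Definition price_avg (w : Omega) : R :=
  d%:R^-1 * \sum_(1 <= j < d.+1) price (tgrid j) w.

Definition stat_y (w : Omega) : R :=
  T / d%:R *
  \sum_(1 <= j < d.+1) price (tgrid j) w * (W (tgrid j) w - sigma * tgrid j).

Definition stat_z (w : Omega) : R :=
  T ^+ 2 / d%:R ^+ 2 *
  \sum_(1 <= i < d.+1) \sum_(i <= j < d.+1)
    price (tgrid i) w * price (tgrid j) w * (W (tgrid j) w - sigma * tgrid j).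

Definition theta_hat (f : R -> R) (weight : R -> R -> R -> R -> R)
    (w : Omega) : R :=
  expR (- r * T) * f (price_avg w) *
  weight (price_avg w) (price (tgrid d) w) (stat_y w) (stat_z w).

End estimators.

Definition binary_payoff (K x : R) : R := if K < x then 1 else 0.

(* The matrix with entries t_{min(i,j)+1} - t_1 for 1 <= i, j <= d - 1,
   rewritten for indices starting at 0. *)
Definition Sigma_mx : 'M[R]_(d.-1) :=
  \matrix_(i, j) (tgrid (minn i j).+2 - tgrid 1).

Definition vec_of_tuple (n : nat) (z : n.-tuple R) : 'cV[R]_n :=
  \col_i tnth z i.

Section conditional_estimates.
Variable A : 'M[R]_(d.-1).

(* Row j of A for 1 <= j <= d - 1, and the zero row for j = 0 (indices j >= d
   are never used). *)
Definition Arow (j : nat) : 'rV[R]_(d.-1) :=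
  if j is k.+1 then
    if insub k is Some i then row i A else 0
  else 0.

Definition AZ (j : nat) (z : (d.-1).-tuple R) : R :=
  (Arow j *m vec_of_tuple z) 0 0.

Definition St (j : nat) (z : (d.-1).-tuple R) : R :=
  S0 * expR (omega * (tgrid j - tgrid 1) + sigma * AZ j.-1 z).

Definition StA (z : (d.-1).-tuple R) : R :=
  d%:R^-1 * \sum_(1 <= j < d.+1) St j z.

Variable K : R.

Definition psi (z : (d.-1).-tuple R) : R :=
  (ln K - ln (StA z) - omega * tgrid 1) / (sigma * Num.sqrt (tgrid 1)).

Definition Phi (x : R) : R := fine (normal_prob 0 1 `]-oo, x]).

Definition Phi1 (z : (d.-1).-tuple R) : R := Phi (- psi z).
Definition Phi2 (z : (d.-1).-tuple R) : R :=
  Phi (- sigma * Num.sqrt (tgrid 1) - psi z).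
Definition Phi3 (z : (d.-1).-tuple R) : R :=
  Phi (- 2 * sigma * Num.sqrt (tgrid 1) - psi z).

Definition G_delta (z : (d.-1).-tuple R) : R :=
  let t1 := tgrid 1 in
  (2 * expR (- r * T) * St d z / (T * S0 * StA z * sigma ^+ 2)
   - 2 * expR (- r * T) * omega / (S0 * sigma ^+ 2)) * Phi1 z
  - 2 * expR (- r * T - r * t1 + sigma ^+ 2 * t1) / (T * StA z * sigma ^+ 2)
    * Phi2 z.

Definition G_gamma (z : (d.-1).-tuple R) : R :=
  let t1 := tgrid 1 in
  4 * expR (- r * T) / (sigma ^+ 4 * S0 ^+ 2 * T ^+ 2) *
  ((St d z ^+ 2 / StA z ^+ 2 + omega * r * T ^+ 2
    - 2 * r * T * St d z / StA z) * Phi1 z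
   + S0 ^+ 2 / StA z ^+ 2 * expR (- 2 * r * t1 + 3 * sigma ^+ 2 * t1) * Phi3 z
   + (2 * omega * T * S0 / StA z - 2 * S0 * St d z / StA z ^+ 2)
     * expR (- r * t1 + sigma ^+ 2 * t1) * Phi2 z).

Definition G_vega (z : (d.-1).-tuple R) : R :=
  let t1 := tgrid 1 in
  let erT := expR (- r * T) in
  let sumA := \sum_(1 <= j < d.+1) St j z * (AZ j.-1 z - sigma * tgrid j) in
  let sumB := \sum_(1 <= i < d.+1) \sum_(i <= j < d.+1)
                St i z * St j z * (AZ j.-1 z - sigma * tgrid j) in
  let sumC := \sum_(1 <= i < d.+1) \sum_(i <= j < d.+1) St i z * St j z in
  Phi1 z *
    (2 * erT * (St d z - (r - sigma ^+ 2) * T * StA z)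
       / (sigma ^+ 2 * T * StA z ^+ 2 * d%:R) * sumA
     - 2 * erT / (d%:R ^+ 2 * StA z ^+ 2) * sumB
     - erT / sigma)
  + Phi2 z *
    (2 * erT * S0 * Num.sqrt t1 / (sigma ^+ 2 * T * StA z)
       * sigma * Num.sqrt t1 * expR (sigma ^+ 2 * t1 / 2 - omega * t1)
     - 2 * S0 * erT / (sigma ^+ 2 * T * d%:R * StA z ^+ 2)
       * expR (- r * t1 + sigma ^+ 2 * t1) * sumA)
  + 1 / Num.sqrt (2 * pi) * expR (- psi z ^+ 2 / 2) *
    (2 * erT * St d z * Num.sqrt t1 / (sigma ^+ 2 * T * StA z)
     - 2 * erT / sigma ^+ 2 * Num.sqrt t1 * (r - sigma ^+ 2)
     - 2 * erT * Num.sqrt t1 / (StA z ^+ 2 * d%:R ^+ 2) * sumC)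
  - 2 * erT * S0 * Num.sqrt t1 / (sigma ^+ 2 * T * StA z)
    * (1 / Num.sqrt (2 * pi)) * expR (sigma ^+ 2 * t1 / 2 - omega * t1)
    * expR (- (psi z + sigma * Num.sqrt t1) ^+ 2 / 2).

End conditional_estimates.
End black_scholes.

(* Main.v *)
Require Import Defs.
From HB Require Import structures.
From mathcomp Require Import all_boot all_order all_algebra.
From mathcomp Require Import all_classical all_reals all_analysis.
From mathcomp Require Import measurable_realfun ring lra zify.
Import Order.TTheory GRing.Theory Num.Theory.
Import numFieldNormedType.Exports.
Local Open Scope classical_set_scope.
Local Open Scope ring_scope.
Set Implicit Arguments.
Unset Strict Implicit.
Unset Printing Implicit Defensive.

(** Freezing [Z] turns the conditional expectation into a one-dimensional
    Gaussian integral.  With [tau = sqrt t_1], [a = sigma * tau] and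
    [om = r - sigma^2 / 2], the whole path factors as
    [S_j = exp (om * t_1 + a * X1) * St j Z], so that

    - the option is exercised, [S_A > K], exactly when [psi Z < X1];
    - each [share j = S_j / S_A] depends on [Z] only, and the only way [X1]
      enters a weight besides the linear term [tau * X1] of the Brownian
      motion is through [S0 / S_A = S0 * exp (- om * t_1) * exp (- a * X1)
      / StA Z].

    Up to a constant factor, each weight is homogeneous of degree zero when
    [S0], [x], [s], [y] have degree one and [z] has degree two.  Hence dividing
    by powers of [S_A] gives every estimate the form
      [1_{psi Z < X1} (c0 Z + c1 Z e^{-a X1} + c2 Z e^{-2 a X1}
                       + c3 Z X1 + c4 Z X1 e^{-a X1})].
    Since [X1] is independent of [Z], the conditional expectation is obtained
    by integrating over the law of [X1] at fixed [Z] ([is_cond_exp_indep], a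
    consequence of Fubini's theorem), and the tail moments of the Gaussian law
    ([integral_tail_expRM], [integral_tail_mul_expRM]) give the terms in
    [Phi1], [Phi2], [Phi3] and the two Gaussian densities of the vega.

    Integrability is part of the claim.  It holds because one summand never
    exceeds the sum and [St 1 = S0]: hence [share j <= d] and
    [1 / StA <= d / S0], and the coefficients [c_k] are bounded, except that
    [c0] and [c1] of the vega also contain sums of bounded functions times
    affine functions of the Gaussian vector [Z]. *)

(** * Conditioning on an independent variable *)

Lemma independent_pair_joint_law (d d1 d2 : measure_display)
    (Omega : measurableType d) (T1 : measurableType d1)
    (T2 : measurableType d2) (R : realType) (P : probability Omega R)
    (mu : probability T1 R) (X : {RV P >-> T1}) (Z : {RV P >-> T2}) :
  (forall B, measurable B -> P (X @^-1` B) = mu B) ->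
  independent_pair P X Z ->
  forall C : set (T1 * T2), measurable C ->
    (mu \x distribution P Z)%E C = P ((fun w => (X w, Z w)) @^-1` C).
Proof.
move=> lawX indXZ.
have mXZ : measurable_fun setT (fun w => (X w, Z w)).
  by apply/measurable_fun_pair.
pose XZ : {mfun Omega >-> (T1 * T2)%type} := mfun_Sub (mem_set mXZ).
apply: (@product_measure_unique _ _ _ _ _ _ _ (distribution P XZ)) => A B mA mB.
transitivity (P (X @^-1` A) * P (Z @^-1` B))%E; first exact: indXZ.
by rewrite lawX.
Qed.

(** Freezing lemma.  By independence the law of [(X, Z)] is a product, so
    integrating [h] over [Z \in C] and integrating first in [X] amount to the
    same, by Fubini's theorem.  Requiring the partial integral [m] to be finite
    at every [z], and not merely almost everywhere, makes [m \o Z] itself a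
    version of the conditional expectation. *)
Lemma is_cond_exp_indep (d d1 d2 : measure_display)
    (Omega : measurableType d) (T1 : measurableType d1)
    (T2 : measurableType d2) (R : realType) (P : probability Omega R)
    (mu : probability T1 R) (X : {RV P >-> T1}) (Z : {RV P >-> T2})
    (h : T1 * T2 -> R) (m : T2 -> R) :
  (forall B, measurable B -> P (X @^-1` B) = mu B) ->
  independent_pair P X Z ->
  (mu \x distribution P Z)%E.-integrable setT (EFin \o h) ->
  (forall z, (\int[mu]_x (h (x, z))%:E = (m z)%:E)%E) ->
  is_cond_exp P (g_sigma_algebra_preimage Z)
    (fun w => h (X w, Z w)) (fun w => m (Z w)).
Proof.
move=> lawX indXZ ih mE.
have joint := independent_pair_joint_law lawX indXZ.
have mXZ : measurable_fun setT (fun w => (X w, Z w)).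
  by apply/measurable_fun_pair.
pose XZ : {mfun Omega >-> (T1 * T2)%type} := mfun_Sub (mem_set mXZ).
have mh := measurable_int _ ih.
have GE : fubini_G mu (EFin \o h) = EFin \o m.
  by apply/funext => z; rewrite /fubini_G /= mE.
have mm : measurable_fun setT (EFin \o m).
  rewrite -GE; apply: measurable_fubini_G ih.
have im : (distribution P Z).-integrable setT (EFin \o m).
  apply/integrableP; split=> //.
  apply: le_lt_trans ((integrable21ltyP _ _ mh).1 ih).
  apply: ge0_le_integral => //; first exact: measurableT_comp.
  - apply: (measurable_fun_fubini_tonelli_G (m1 := mu)
      (abse \o (EFin \o h))) => //=.
    exact: measurableT_comp.
  - move=> z _; rewrite /= -[_%:E]/(`|(m z)%:E|)%E -mE.
    apply: le_abse_integral => //.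
    exact: (measurableT_comp mh).
have ihXZ : P.-integrable setT (EFin \o h \o XZ).
  apply/integrableP; split; first exact: measurableT_comp.
  case/integrableP : ih => _.
  rewrite (eq_measure_integral (distribution P XZ)); last first.
    by move=> A mA _; exact: joint.
  by rewrite ge0_integral_pushforward//; exact: measurableT_comp.
have imZ : P.-integrable setT (EFin \o m \o Z).
  apply/integrableP; split; first exact: measurableT_comp.
  case/integrableP : im => _.
  by rewrite ge0_integral_pushforward//; exact: measurableT_comp.
split => //.
- move=> B mB; exists (m @^-1` B); last by rewrite setTI.
  by rewrite -[X in measurable X]setTI; by move: mm => /measurable_EFinP; apply.
- move=> _ [C mC <-]; rewrite setTI.
  have mSC : measurable (@snd T1 T2 @^-1` C).
    by rewrite -[X in measurable X]setTI; exact: measurable_snd.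
  transitivity (\int[distribution P XZ]_(u in @snd T1 T2 @^-1` C) (h u)%:E)%E.
    rewrite integral_pushforward//.
    apply: (integrableS measurableT) => //.
    exact: (measurable_funPTI XZ).
  rewrite -(@eq_measure_integral _ _ _ _ _ (mu \x distribution P Z)%E);
    last by move=> A mA _; exact: joint.
  rewrite integral_mkcond -integral21_prod_meas1; last first.
    by apply/(integrable_mkcond _ mSC).1; exact: (integrableS measurableT).
  transitivity (\int[distribution P Z]_(z in C) (m z)%:E)%E.
    rewrite [RHS]integral_mkcond; apply: eq_integral => z _.
    rewrite /fubini_G /patch; case: ifPn => zC.
      rewrite -mE; apply: eq_integral => x _.
      by rewrite ifT//; move: zC; rewrite !inE.
    apply: integral0_eq => x _.
    by rewrite ifF//; apply/negbTE; move: zC; rewrite !notin_setE.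
  rewrite integral_pushforward//; apply: (integrableS measurableT) => //.
  by rewrite -[X in measurable X]setTI; exact: (measurable_funP Z).
Qed.

(** * Integration against a Gaussian law *)

Section density.
Context {R : realType}.
Notation mu := (@lebesgue_measure R).
Implicit Types (m s : R) (E : set R) (f : R -> \bar R).

Lemma normal_density_ae_unique m s E (g : R -> \bar R) :
  measurable E -> mu.-integrable setT g ->
  (forall A, measurable A ->
    normal_prob m s A = (\int[mu]_(x in A) g x)%E) ->
  ae_eq mu E g (EFin \o normal_pdf m s).
Proof.
move=> mE ig gE; apply: integral_ae_eq => //.
- exact: (integrableS measurableT).
- apply/measurable_funTS/measurable_EFinP; exact: measurable_normal_pdf.
- by move=> A _ mA; rewrite -gE.
Qed.

Lemma ge0_integral_normal_prob m s E f :
  measurable E -> measurable_fun E f -> (forall x, (0 <= f x)%E) ->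
  (\int[normal_prob m s]_(x in E) f x
   = \int[mu]_(x in E) (f x * (normal_pdf m s x)%:E))%E.
Proof.
move=> mE mf f0; have dom := normal_prob_dominates m s.
rewrite -(Radon_Nikodym_SigmaFinite.change_of_variables dom)//.
apply: ae_eq_integral => //.
- apply: emeasurable_funM => //; apply: (measurable_int mu).
  apply: (integrableS measurableT) => //.
  exact: Radon_Nikodym_SigmaFinite.f_integrable.
- apply: emeasurable_funM => //.
  apply/measurable_funTS/measurable_EFinP; exact: measurable_normal_pdf.
- apply: ae_eqe_mul2l; apply: normal_density_ae_unique => //.
    exact: Radon_Nikodym_SigmaFinite.f_integrable.
  by move=> A mA; exact: Radon_Nikodym_SigmaFinite.f_integral.
Qed.

(** The version for signed functions, which the first moment requires. *)
Lemma integral_normal_prob m s E f :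
  measurable E -> (normal_prob m s).-integrable E f ->
  (\int[normal_prob m s]_(x in E) f x
   = \int[mu]_(x in E) (f x * (normal_pdf m s x)%:E))%E.
Proof.
move=> mE intf; have dom := normal_prob_dominates m s.
have mf := measurable_int _ intf.
rewrite -(Radon_Nikodym_change_of_variables dom)//.
apply: ae_eq_integral => //.
- apply: emeasurable_funM => //; apply: (measurable_int mu).
  apply: (integrableS measurableT) => //.
  exact: Radon_Nikodym_integrable.
- apply: emeasurable_funM => //.
  apply/measurable_funTS/measurable_EFinP; exact: measurable_normal_pdf.
- apply: ae_eqe_mul2l; apply: normal_density_ae_unique => //.
    exact: Radon_Nikodym_integrable.
  by move=> A mA; rewrite -Radon_Nikodym_integral.
Qed.

End density.

(** * Gaussian tail moments *)

Section tail_moments.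
Context {R : realType}.
Notation mu := (@lebesgue_measure R).
Notation N01 := (normal_prob (0 : R) 1).
Implicit Types (b u x : R).

Lemma normal_pdf1E b x :
  normal_pdf b 1 x = (Num.sqrt (2 * pi))^-1 * expR (- (x - b) ^+ 2 / 2).
Proof.
rewrite normal_pdfE ?oner_neq0// /normal_peak /normal_fun expr1n mul1r.
by rewrite -[pi *+ 2]mulr_natl.
Qed.

(** Exponential tilting: completing the square turns the weight [expR (b * x)]
    into a shift of the mean by [b].  All tail moments below come from this. *)
Lemma expRM_normal_pdf b x :
  expR (b * x) * normal_pdf 0 1 x = expR (b ^+ 2 / 2) * normal_pdf b 1 x.
Proof.
rewrite !normal_pdf1E mulrCA [RHS]mulrCA -!expRD.
by congr (_ * expR _); field.
Qed.

(** The substitution [x |-> b - x] preserves Lebesgue measure and exchanges the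
    two densities. *)
Lemma normal_prob_reflect b u :
  normal_prob b 1 `]u, +oo[ = N01 `]-oo, b - u].
Proof.
have db x : is_derive x 1 (fun y : R => b - y) (-1).
  by rewrite -[-1]add0r; apply: is_deriveB.
have db' : ((fun y : R => b - y)^`()%classic) = cst (-1).
  by apply/funext => y; rewrite derive1E derive_val.
rewrite /normal_prob integral_itv_obnd_cbnd; last first.
  by apply/measurable_funTS/measurable_EFinP; exact: measurable_normal_pdf.
rewrite (@decreasing_ge0_integration_by_substitutiony _ (fun y => b - y)).
- apply: eq_integral => x _; rewrite db' /= opprK mulr1; congr (_%:E).
  by rewrite /comp !normal_pdf1E subr0 -sqrrN opprB.
- by move=> x y _ _ xy; rewrite ltrD2l ltrN2.
- by rewrite db' => x _; exact: cst_continuous.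
- by rewrite db'; exact: is_cvg_cst.
- by rewrite db'; exact: is_cvg_cst.
- split=> [x _|]; first exact: ex_derive.
  by apply: cvg_at_right_filter; apply: cvgB; [exact: cvg_cst|exact: cvg_id].
- rewrite [X in X @ _](_ : _ = - (fun x : R => x - b)); last first.
    by apply/funext => x; rewrite fctE opprB.
  by apply/cvgNrNy; exact: cvg_addrr.
- apply: continuous_subspaceT => x.
  by apply: continuous_normal_pdf; rewrite oner_neq0.
- by move=> x _; exact: normal_pdf_ge0.
Qed.

Lemma integral_tail_expRM b u :
  (\int[N01]_(x in `]u, +oo[) (expR (b * x))%:E
   = (expR (b ^+ 2 / 2) * Phi (b - u))%:E)%E.
Proof.
have mexp : measurable_fun setT (fun x : R => expR (b * x)).
  by apply: measurableT_comp => //; exact: measurable_funM.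
rewrite ge0_integral_normal_prob//; last first.
  exact/measurable_funTS/measurable_EFinP.
under eq_integral do rewrite -EFinM expRM_normal_pdf EFinM.
rewrite ge0_integralZl//.
- have -> : (\int[mu]_(x in `]u, +oo[) (normal_pdf b 1 x)%:E)%E
            = normal_prob b 1 `]u, +oo[ by [].
  rewrite normal_prob_reflect EFinM; congr *%E.
  by rewrite /Phi fineK// fin_num_measure.
- by apply/measurable_funTS/measurable_EFinP; exact: measurable_normal_pdf.
- by move=> x _; rewrite lee_fin normal_pdf_ge0.
Qed.

Lemma integrable_expRM b : N01.-integrable setT (fun x => (expR (b * x))%:E).
Proof.
have mexp : measurable_fun setT (fun x : R => expR (b * x)).
  by apply: measurableT_comp => //; exact: measurable_funM.
apply/integrableP; split; first exact/measurable_EFinP.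
under eq_integral do rewrite gee0_abs ?lee_fin ?expR_ge0//.
rewrite ge0_integral_normal_prob//; last exact/measurable_EFinP.
under eq_integral do rewrite -EFinM expRM_normal_pdf EFinM.
rewrite ge0_integralZl//.
- by rewrite integral_normal_pdf mule1 ltry.
- by apply/measurable_EFinP; exact: measurable_normal_pdf.
- by move=> x _; rewrite lee_fin normal_pdf_ge0.
Qed.

(** Dominates [`|x|] by exponentials, so that the integrability of
    [x * expR (b * x)] reduces to that of [expR ((b + 1) * x)] and
    [expR ((b - 1) * x)]. *)
Lemma normr_le_expRD x : `|x| <= expR x + expR (- x).
Proof.
have h1 := expR_ge1Dx x; have h2 := expR_ge1Dx (- x).
have h3 := expR_ge0 x; have h4 := expR_ge0 (- x).
by rewrite ler_norml; lra.
Qed.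

Lemma integrable_mul_expRM b :
  N01.-integrable setT (fun x => (x * expR (b * x))%:E).
Proof.
have mexp : measurable_fun setT (fun x : R => x * expR (b * x)).
  apply: measurable_funM => //.
  by apply: measurableT_comp => //; exact: measurable_funM.
apply: (le_integrable measurableT) (integrableD measurableT
  (integrable_expRM (b + 1)) (integrable_expRM (b - 1))).
  exact/measurable_EFinP.
move=> x _; rewrite /= !lee_fin normrM (ger0_norm (expR_ge0 _)).
rewrite [leRHS]ger0_norm ?addr_ge0 ?expR_ge0//.
rewrite !mulrDl mul1r mulN1r !expRD -mulrDr mulrC ler_wpM2l ?expR_ge0//.
exact: normr_le_expRD.
Qed.


Lemma derive_normal_pdf b x :
  is_derive x 1 (normal_pdf b 1) (- ((x - b) * normal_pdf b 1 x)).
Proof.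
rewrite normal_pdfE ?oner_neq0// /normal_fun.
apply: is_derive_eq; rewrite scaler0 /GRing.scale /=.
by field.
Qed.

Lemma cvg_normal_pdf b : normal_pdf b 1 x @[x --> +oo] --> (0 : R).
Proof.
have -> : normal_pdf b 1 = fun x =>
    (Num.sqrt (2 * pi))^-1 * gauss_fun ((x - b) / Num.sqrt 2).
  apply/funext => x; rewrite normal_pdf1E /gauss_fun.
  by rewrite exprMn exprVn sqr_sqrtr ?ler0n// mulNr.
rewrite -[X in _ --> X](mulr0 (Num.sqrt (2 * pi))^-1).
apply: cvgM; first exact: cvg_cst.
apply: (cvg_comp _ _ _ cvg_gauss_fun).
apply/gt0_cvgMly; last exact: cvg_addrr.
by rewrite invr_gt0 sqrtr_gt0 ltr0n.
Qed.

(** The integrand is the derivative of [- c * normal_pdf b 1].  As the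
    fundamental theorem on a half-line, [ge0_continuous_FTC2y], concerns
    nonnegative integrands, the domain is split at the mean [b], where the sign
    changes. *)
Lemma integral_tail_mul_pdf (c b u : R) : 0 <= c ->
  (\int[mu]_(x in `[u, +oo[) (c * ((x - b) * normal_pdf b 1 x))%:E
   = (c * normal_pdf b 1 u)%:E)%E.
Proof.
move=> c0; pose F x := - (c * normal_pdf b 1 x).
pose f x := c * ((x - b) * normal_pdf b 1 x).
have dF x : is_derive x 1 F (f x).
  rewrite -[f x]opprK -mulrN; apply: is_deriveN.
  by apply: is_deriveZ; exact: derive_normal_pdf.
have F'f x : F^`()%classic x = f x by rewrite derive1E derive_val.
have cpdf : continuous (normal_pdf b 1 : R -> R).
  by apply: continuous_normal_pdf; rewrite oner_neq0.
have cF : continuous F.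
  by move=> x; apply: cvgN; apply: cvgM; [exact: cvg_cst|exact: cpdf].
have cf : continuous f.
  move=> x; apply: cvgM; first exact: cvg_cst.
  apply: cvgM; last exact: cpdf.
  by apply: cvgB; [exact: cvg_id|exact: cvg_cst].
have Foo : F x @[x --> +oo] --> (0 : R).
  rewrite -oppr0 -(mulr0 c); apply: cvgN; apply: cvgM; first exact: cvg_cst.
  exact: cvg_normal_pdf.
(* beyond the mean [b] the integrand is nonnegative *)
have right_tail v : b <= v ->
    (\int[mu]_(x in `[v, +oo[) (f x)%:E = (- F v)%:E)%E.
  move=> bv; rewrite (@ge0_continuous_FTC2y _ f F _ 0)//.
  - by rewrite sub0e.
  - move=> x vx; rewrite !mulr_ge0 ?normal_pdf_ge0// subr_ge0.
    exact: le_trans vx.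
  - exact: continuous_subspaceT.
  - by apply: cvg_at_right_filter; exact: cF.
have [bu|ub] := leP b u; first by rewrite right_tail// opprK.
have mf D : measurable_fun D (EFin \o f).
  apply/measurable_funTS/measurable_EFinP; exact: continuous_measurable_fun.
have -> : `[u, +oo[%classic = `[u, b[%classic `|` `[b, +oo[%classic.
  by rewrite -itv_bndbnd_setU//= bnd_simp// ltW.
rewrite integral_setU//.
- rewrite right_tail// integral_itv_bndo_bndc// (@continuous_FTC2 _ f F)//.
  + transitivity ((F b - F u - F b)%:E) => //.
    by rewrite /F; congr _%:E; ring.
  + exact: continuous_subspaceT.
  + split=> [x _|//|//]; first exact: ex_derive.
    * by apply: cvg_at_right_filter; exact: cF.
    * by apply: cvg_at_left_filter; exact: cF.
- exact: mf.
- apply/disj_setPS => x [/=]; rewrite !in_itv/= andbT => /andP[_ xb] bx.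
  by have := lt_le_trans xb bx; rewrite ltxx.
Qed.

(** Write [x = (x - b) + b]: after tilting, the first part integrates exactly
    to the density at [u] and the second is a multiple of the tail. *)
Lemma integral_tail_mul_expRM b u :
  (\int[N01]_(x in `]u, +oo[) (x * expR (b * x))%:E
   = (expR (b ^+ 2 / 2) * (normal_pdf b 1 u + b * Phi (b - u)))%:E)%E.
Proof.
have iexp := integrable_expRM b; have ixexp := integrable_mul_expRM b.
have mI : measurable (`]u, +oo[%classic : set R) by exact: measurable_itv.
have ibexp : N01.-integrable `]u, +oo[ (fun x => b%:E * (expR (b * x))%:E)%E.
  by apply: integrableZl => //; exact: (integrableS measurableT).
have icentered : N01.-integrable `]u, +oo[
    (fun x => ((x - b) * expR (b * x))%:E).
  rewrite (_ : (fun _ => _) =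
    (fun x => (x * expR (b * x))%:E) \- (fun x => b%:E * (expR (b * x))%:E))%E;
    last by apply/funext => x; rewrite mulrBl.
  by apply: integrableB => //; exact: (integrableS measurableT).
transitivity (\int[N01]_(x in `]u, +oo[)
    (((x - b) * expR (b * x))%:E + b%:E * (expR (b * x))%:E))%E.
  apply: eq_integral => x _.
  transitivity (((x - b) * expR (b * x) + b * expR (b * x))%:E) => //.
  by congr _%:E; ring.
rewrite integralD// integralZl//; last exact: (integrableS measurableT).
rewrite integral_tail_expRM integral_normal_prob//.
under eq_integral do rewrite -EFinM -mulrA expRM_normal_pdf mulrCA.
rewrite integral_itv_obnd_cbnd; last first.
  apply/measurable_funTS/measurable_EFinP; apply: measurable_funM => //.
  apply: measurable_funM; first exact: measurable_funB.
  exact: measurable_normal_pdf.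
rewrite integral_tail_mul_pdf ?expR_ge0// -EFinM -EFinD.
by congr _%:E; ring.
Qed.

End tail_moments.

Lemma normal_law_integrable (d : measure_display) (Omega : measurableType d)
    (R : realType) (P : probability Omega R) (Y : Omega -> R) :
  measurable_fun setT Y -> normal_law P 0 1 Y ->
  P.-integrable setT (EFin \o Y).
Proof.
move=> mY lawY; apply/integrableP; split; first exact/measurable_EFinP.
pose Y' : {mfun Omega >-> measurableTypeR R} :=
  @mfun_Sub _ _ Omega (measurableTypeR R) Y (mem_set mY).
have : (\int[pushforward P Y']_x `|x%:E| < +oo)%E.
  rewrite (eq_measure_integral (normal_prob (0 : R) 1)); last first.
    by move=> B mB _; rewrite -[in RHS](sqrtr1 R); exact: lawY.
  have /integrableP[_] := @integrable_mul_expRM R 0.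
  congr (_ < _)%E; apply: eq_integral => x _.
  by rewrite mul0r expR0 mulr1.
rewrite ge0_integral_pushforward//.
by apply/measurableT_comp => //; exact/measurable_EFinP.
Qed.

(** * Functions with an everywhere finite partial integral *)

Section partial_integral.
Context {d1 d2 : measure_display} {T1 : measurableType d1}
  {T2 : measurableType d2} {R : realType}.
Variables (mu : probability T1 R) (nu : probability T2 R).

(** The hypotheses of the freezing lemma on [h] and [m], strengthened by the
    integrability of every section so as to be stable under addition. *)
Definition partial_integral (h : T1 * T2 -> R) (m : T2 -> R) : Prop :=
  [/\ (mu \x nu)%E.-integrable setT (EFin \o h),
      forall z, mu.-integrable setT (fun x => (h (x, z))%:E) &
      forall z, (\int[mu]_x (h (x, z))%:E = (m z)%:E)%E].

Lemma partial_integralD h1 m1 h2 m2 :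
  partial_integral h1 m1 -> partial_integral h2 m2 ->
  partial_integral (fun u => h1 u + h2 u) (fun z => m1 z + m2 z).
Proof.
move=> [ih1 sh1 hm1] [ih2 sh2 hm2]; split.
- exact: (integrableD measurableT ih1 ih2).
- by move=> z; exact: (integrableD measurableT (sh1 z) (sh2 z)).
- move=> z; under eq_integral do rewrite EFinD.
  by rewrite integralD// hm1 hm2.
Qed.

Lemma integrable_mul_prod (g : T1 -> R) (c : T2 -> R) :
  mu.-integrable setT (EFin \o g) -> nu.-integrable setT (EFin \o c) ->
  (mu \x nu)%E.-integrable setT (fun u => (c u.2 * g u.1)%:E).
Proof.
move=> ig ic.
have mg : measurable_fun setT g.
  by apply/measurable_EFinP; exact: measurable_int ig.
have mc : measurable_fun setT c.
  by apply/measurable_EFinP; exact: measurable_int ic.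
have iga := integrable_lty measurableT (integrable_abse ig).
have ica := integrable_lty measurableT (integrable_abse ic).
apply/integrable21ltyP.
  apply/measurable_EFinP; apply: measurable_funM.
    exact: (measurableT_comp mc).
  exact: (measurableT_comp mg).
under eq_integral => z _.
  under eq_integral do rewrite /= normrM EFinM.
  rewrite ge0_integralZl//=; last exact/measurable_EFinP/measurableT_comp.
  over.
rewrite /= ge0_integralZr//=.
- apply: lte_mul_pinfty => //.
    + exact: integral_ge0.
    + exact: (integrable_fin_num measurableT (integrable_abse ic)).
- exact/measurable_EFinP/measurableT_comp.
- exact: integral_ge0.
Qed.

End partial_integral.

Lemma partial_integral_tail (d1 d2 : measure_display)
    (T1 : measurableType d1) (T2 : measurableType d2) (R : realType)
    (mu : probability T1 R) (nu : probability T2 R)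
    (s g : T1 -> R) (m : R -> R) (c psi : T2 -> R) :
  measurable_fun setT s -> mu.-integrable setT (EFin \o g) ->
  (forall v, (\int[mu]_(x in [set x | (v < s x)%R]) (g x)%:E = (m v)%:E)%E) ->
  nu.-integrable setT (EFin \o c) -> measurable_fun setT psi ->
  partial_integral mu nu
    (fun u => c u.2 * (if psi u.2 < s u.1 then g u.1 else 0))
    (fun z => c z * m (psi z)).
Proof.
move=> ms ig gm ic mpsi.
have mg : measurable_fun setT g.
  by apply/measurable_EFinP; exact: measurable_int ig.
have mc : measurable_fun setT c.
  by apply/measurable_EFinP; exact: measurable_int ic.
have itail v : mu.-integrable setT (fun x => (if v < s x then g x else 0)%:E).
  apply: (le_integrable measurableT _ _ ig).
    apply/measurable_EFinP; apply: measurable_fun_ifT => //.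
    exact: measurable_fun_ltr.
  by move=> x _; rewrite lee_fin; case: ifP => // _; rewrite normr0.
split.
- apply: (le_integrable measurableT _ _ (integrable_mul_prod ig ic)).
    apply/measurable_EFinP; apply: measurable_funM.
      exact: (measurableT_comp mc).
    apply: measurable_fun_ifT => //; last exact: (measurableT_comp mg).
    apply: measurable_fun_ltr; first exact: (measurableT_comp mpsi).
    exact: (measurableT_comp ms).
  move=> [x z] _; rewrite lee_fin !normrM ler_wpM2l//=.
  by case: ifP => // _; rewrite normr0.
- move=> z; rewrite [X in integrable _ _ X](_ : _ =
    (fun x => (c z)%:E * (if psi z < s x then g x else 0)%:E)%E)//.
  by apply: integrableZl => //; exact: itail.
- move=> z; transitivity
    ((c z)%:E * \int[mu]_x (if psi z < s x then g x else 0)%:E)%E.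
    by rewrite -integralZl//; apply: eq_integral.
  rewrite EFinM -gm; congr *%E.
  rewrite [RHS]integral_mkcond; apply: eq_integral => x _.
  rewrite patchE; case: ifPn => sx; first by rewrite mem_set.
  by rewrite memNset//; exact/negP.
Qed.

(** * Conditional expectation of a Gaussian tail *)

Section gaussian_tail.
Context {d d2 : measure_display} {Omega : measurableType d}
  {T2 : measurableType d2} {R : realType}.
Variables (P : probability Omega R) (X : {RV P >-> R}) (Z : {RV P >-> T2}).

(** The common form of the three estimates: delta and gamma have
    [c3 = c4 = 0], and delta and vega have [c2 = 0]. *)
Lemma is_cond_exp_gaussian_tail (a : R) (psi c0 c1 c2 c3 c4 : T2 -> R) :
  normal_law P 0 1 X -> independent_pair P X Z ->
  measurable_fun setT psi ->
  (distribution P Z).-integrable setT (EFin \o c0) ->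
  (distribution P Z).-integrable setT (EFin \o c1) ->
  (distribution P Z).-integrable setT (EFin \o c2) ->
  (distribution P Z).-integrable setT (EFin \o c3) ->
  (distribution P Z).-integrable setT (EFin \o c4) ->
  is_cond_exp P (g_sigma_algebra_preimage Z)
    (fun w => let x := X w in let z := Z w in
      if psi z < x then
        c0 z + c1 z * expR (- a * x) + c2 z * expR (- (2 * a) * x)
        + c3 z * x + c4 z * (x * expR (- a * x))
      else 0)
    (fun w => let z := Z w in
      c0 z * Phi (- psi z)
      + c1 z * (expR (a ^+ 2 / 2) * Phi (- a - psi z))
      + c2 z * (expR (2 * a ^+ 2) * Phi (- (2 * a) - psi z))
      + c3 z * normal_pdf 0 1 (psi z)
      + c4 z * (expR (a ^+ 2 / 2) *
          (normal_pdf (- a) 1 (psi z) - a * Phi (- a - psi z)))).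
Proof.
move=> lawX indXZ mpsi i0 i1 i2 i3 i4.
have lawN B : measurable B -> P (X @^-1` B) = normal_prob 0 1 B.
  by move=> mB; rewrite lawX// sqrtr1.
(* [normal_prob] is a measure on [measurableTypeR R], which has the Borel sets
   of [R] but another display than [R] itself *)
pose TR := measurableTypeR R.
have mX : @measurable_fun _ _ Omega TR setT X by exact: (measurable_funP X).
pose X' : {RV P >-> TR} := @mfun_Sub _ _ Omega TR X (mem_set mX).
pose N : probability TR R := normal_prob (0 : R) 1.
have tailE u : [set x : TR | u < x] = `]u, +oo[%classic.
  by apply/seteqP; split=> x /=; rewrite in_itv/= andbT.
pose exp_tail (b u : R) := expR (b ^+ 2 / 2) * Phi (b - u).
pose mulexp_tail (b u : R) :=
  expR (b ^+ 2 / 2) * (normal_pdf b 1 u + b * Phi (b - u)).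
have pexp b c : (distribution P Z).-integrable setT (EFin \o c) ->
    partial_integral N (distribution P Z)
      (fun u => c u.2 * (if psi u.2 < u.1 then expR (b * u.1) else 0))
      (fun z => c z * exp_tail b (psi z)).
  move=> ic; apply: (@partial_integral_tail _ _ TR _ _ N _ (fun x : TR => x : R)
    (fun x : TR => expR (b * (x : R)))) => //.
    exact: integrable_expRM.
  by move=> u; rewrite tailE; exact: integral_tail_expRM.
have pmulexp b c : (distribution P Z).-integrable setT (EFin \o c) ->
    partial_integral N (distribution P Z)
      (fun u => c u.2 * (if psi u.2 < u.1 then u.1 * expR (b * u.1) else 0))
      (fun z => c z * mulexp_tail b (psi z)).
  move=> ic; apply: (@partial_integral_tail _ _ TR _ _ N _ (fun x : TR => x : R)
    (fun x : TR => (x : R) * expR (b * (x : R)))) => //.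
    exact: integrable_mul_expRM.
  by move=> u; rewrite tailE; exact: integral_tail_mul_expRM.
have [ih _ hm] := partial_integralD (partial_integralD (partial_integralD
  (partial_integralD (pexp 0 _ i0) (pexp (- a) _ i1)) (pexp (- (2 * a)) _ i2))
  (pmulexp 0 _ i3)) (pmulexp (- a) _ i4).
have := @is_cond_exp_indep _ _ _ _ TR _ _ _ _ X' _ _ _ lawN indXZ ih hm.
congr is_cond_exp; apply/funext => w /=.
- by case: ifP => _; rewrite ?mul0r ?expR0 ?mulr1 ?mulr0 ?addr0.
- rewrite /exp_tail /mulexp_tail expr0n/= !mul0r expR0 !mul1r sub0r addr0.
  rewrite sqrrN mulNr.
  by rewrite (_ : (- (2 * a)) ^+ 2 / 2 = 2 * a ^+ 2)//; field.
Qed.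

End gaussian_tail.

(** * Bounded measurable coefficients *)

Section bounded_coefficients.
Context {d : measure_display} {T : measurableType d} {R : realType}.
Implicit Types (f g : T -> R).

Definition bounded_measurable f : Prop :=
  measurable_fun setT f /\ exists M, forall x, `|f x| <= M.

Lemma bounded_measurable_cst (c : R) : bounded_measurable (fun=> c).
Proof. by split=> //; exists `|c|. Qed.

Lemma bounded_measurableD f g : bounded_measurable f -> bounded_measurable g ->
  bounded_measurable (fun x => f x + g x).
Proof.
move=> [mf [M fM]] [mg [N gN]]; split; first exact: measurable_funD.
by exists (M + N) => x; rewrite (le_trans (ler_normD _ _))// lerD.
Qed.

Lemma bounded_measurableM f g : bounded_measurable f -> bounded_measurable g ->
  bounded_measurable (fun x => f x * g x).
Proof.
move=> [mf [M fM]] [mg [N gN]]; split; first exact: measurable_funM.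
by exists (M * N) => x; rewrite normrM ler_pM.
Qed.

Lemma bounded_measurable_sum (I : Type) (s : seq I) (p : pred I)
    (f : I -> T -> R) : (forall i, p i -> bounded_measurable (f i)) ->
  bounded_measurable (fun x => \sum_(i <- s | p i) f i x).
Proof.
move=> bf; rewrite [X in bounded_measurable X](_ : _ =
    \sum_(i <- s | p i) f i); last by apply/funext => x; rewrite fct_sumE.
elim/big_ind : _ => [|g h bg bh|//]; first exact: bounded_measurable_cst.
exact: bounded_measurableD.
Qed.

Variable nu : probability T R.

Lemma integrable_bounded_measurable f :
  bounded_measurable f -> nu.-integrable setT (EFin \o f).
Proof.
move=> [mf [M fM]].
apply: (le_integrable measurableT _ _
  (finite_measure_integrable_cst nu M measurableT)).
  exact/measurable_EFinP.
by move=> x _; rewrite lee_fin (le_trans (fM x))// ler_norm.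
Qed.

Lemma integrable_bounded_measurableM f g :
  bounded_measurable f -> nu.-integrable setT (EFin \o g) ->
  nu.-integrable setT (EFin \o (fun x => f x * g x)).
Proof.
move=> [mf [M fM]] ig; apply: (integrableMr measurableT mf _ ig).
exists M; split; first exact: num_real.
by move=> y My x _; exact: le_trans (fM x) (ltW My).
Qed.

Lemma integrable_addr f g :
  nu.-integrable setT (EFin \o f) -> nu.-integrable setT (EFin \o g) ->
  nu.-integrable setT (EFin \o (fun x => f x + g x)).
Proof. by move=> fi gi; exact: (integrableD measurableT fi gi). Qed.

Lemma integrable_sumr (I : Type) (s : seq I) (p : pred I) (f : I -> T -> R) :
  (forall i, p i -> nu.-integrable setT (EFin \o f i)) ->
  nu.-integrable setT (EFin \o (fun x => \sum_(i <- s | p i) f i x)).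
Proof.
move=> intf; rewrite [X in integrable _ _ X](_ : _ =
    EFin \o \sum_(i <- s | p i) f i); last first.
  by apply/funext => x /=; rewrite fct_sumE.
elim/big_ind : _ => [|g h ig ih|//].
  apply: integrable_bounded_measurable; exact: bounded_measurable_cst.
exact: integrable_addr.
Qed.

End bounded_coefficients.

(** * The part of the path driven by [Z] *)

Section black_scholes_path.
Context {R : realType}.
Variables (S0 r sigma T : R) (d : nat) (A : 'M[R]_(d.-1)).
Hypotheses (hS0 : 0 < S0) (hsigma : 0 < sigma) (hT : 0 < T) (hd : (2 <= d)%N).

Local Notation t j := (tgrid T d j).
Local Notation om := (omega r sigma).
Local Notation S_ := (@St R S0 r sigma T d A).
Local Notation SA := (@StA R S0 r sigma T d A).
Local Notation vec := ((d.-1).-tuple R).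
Implicit Types (z : vec) (i j : nat).

Let d_gt0 : (0 : R) < d%:R. Proof. by rewrite ltr0n; case: d hd. Qed.

Lemma t1_gt0 : 0 < t 1.
Proof. by rewrite /tgrid mul1r divr_gt0. Qed.

Lemma AZE j z : AZ A j z = \sum_i Arow A j 0 i * tnth z i.
Proof. by rewrite /AZ mxE; apply: eq_bigr => i _; rewrite mxE. Qed.

Lemma measurable_AZ j : measurable_fun setT (AZ A j).
Proof.
rewrite (_ : AZ A j = fun z => \sum_i Arow A j 0 i * tnth z i).
  apply: measurable_sum => i; apply: measurable_funM => //.
  exact: measurable_tnth.
by apply/funext => z; exact: AZE.
Qed.

Lemma St_gt0 j z : 0 < S_ j z. Proof. by rewrite mulr_gt0 ?expR_gt0. Qed.

(** The first price carries no [Z]: this keeps [StA] away from zero. *)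
Lemma St1 z : S_ 1 z = S0.
Proof.
rewrite /St AZE subrr mulr0 big1 ?mulr0 ?addr0 ?expR0 ?mulr1// => i _.
by rewrite mxE mul0r.
Qed.

Lemma measurable_St j : measurable_fun setT (S_ j).
Proof.
apply: measurable_funM => //; apply: measurableT_comp => //.
apply: measurable_funD => //; apply: measurable_funM => //.
exact: measurable_AZ.
Qed.

Lemma sum_St z : \sum_(1 <= j < d.+1) S_ j z = d%:R * SA z.
Proof. by rewrite /StA mulrA divff ?mul1r// gt_eqF. Qed.

Lemma le_St_sum j z : (1 <= j < d.+1)%N -> S_ j z <= d%:R * SA z.
Proof.
move=> jd; rewrite -sum_St (big_rem j)/= ?mem_index_iota// lerDl.
by apply: sumr_ge0 => i _; exact/ltW/St_gt0.
Qed.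

Lemma StA_gt0 z : 0 < SA z.
Proof.
have : 0 < d%:R * SA z.
  apply: lt_le_trans (@le_St_sum 1 z _); first exact: St_gt0.
  by rewrite ltnS; case: d hd.
by rewrite pmulr_rgt0.
Qed.

Lemma measurable_StA : measurable_fun setT SA.
Proof.
apply: measurable_funM => //; apply: measurable_sum => j; exact: measurable_St.
Qed.

(** [share j] is also [S_j / S_A], the factor driven by [X1] cancelling. *)
Definition share j z := S_ j z / SA z.
Definition inv_avg z := (SA z)^-1.
Definition dev j z := AZ A j.-1 z - sigma * t j.
(** Up to the factors [T / d * S_A] and [T^2 / d^2 * S_A^2], [share_dev] and
    [share2_dev] are the parts of the statistics [y] and [z] that do not involve
    [X1], and [d] and [share2] the coefficients of [tau * X1]. *)
Definition share_dev z := \sum_(1 <= j < d.+1) share j z * dev j z.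
Definition share2 z :=
  \sum_(1 <= i < d.+1) \sum_(i <= j < d.+1) share i z * share j z.
Definition share2_dev z :=
  \sum_(1 <= i < d.+1) \sum_(i <= j < d.+1) share i z * share j z * dev j z.

Lemma bounded_inv_avg : bounded_measurable inv_avg.
Proof.
split.
  rewrite (_ : inv_avg = expR \o -%R \o @ln R \o SA).
    apply: measurableT_comp; last exact: measurable_StA.
    by do 2!apply: measurableT_comp => //.
  by apply/funext => z /=; rewrite expRN lnK// posrE StA_gt0.
exists (d%:R / S0) => z; rewrite ger0_norm ?invr_ge0 ?(ltW (StA_gt0 z))//.
rewrite -[leLHS]mul1r ler_pdivrMr ?StA_gt0// mulrAC ler_pdivlMr// mul1r.
by rewrite -[leLHS](St1 z) le_St_sum// ltnS; case: d hd.
Qed.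

Lemma bounded_share j : (1 <= j < d.+1)%N -> bounded_measurable (share j).
Proof.
move=> jd; split.
  by apply: measurable_funM; [exact: measurable_St|case: bounded_inv_avg].
exists d%:R => z.
rewrite ger0_norm ?divr_ge0 ?(ltW (StA_gt0 z)) ?(ltW (St_gt0 _ _))//.
by rewrite ler_pdivrMr ?StA_gt0// le_St_sum.
Qed.

Lemma bounded_share2 : bounded_measurable share2.
Proof.
rewrite [X in bounded_measurable X](_ : _ = fun z =>
    \sum_(1 <= i < d.+1 | (1 <= i < d.+1)%N)
      \sum_(i <= j < d.+1 | (i <= j < d.+1)%N) share i z * share j z);
  last first.
  apply/funext => z; rewrite /share2 big_nat.
  by apply: eq_bigr => i _; rewrite big_nat.
apply: bounded_measurable_sum => i /andP[i1 id].
apply: bounded_measurable_sum => j /andP[ij jd].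
by apply: bounded_measurableM; apply: bounded_share; lia.
Qed.

Section integrability.
Variable nu : probability vec R.
Hypothesis inu : forall i : 'I_d.-1,
  nu.-integrable setT (fun z => (tnth z i)%:E).

Lemma integrable_dev j : nu.-integrable setT (EFin \o dev j).
Proof.
rewrite [X in EFin \o X](_ : _ = fun z =>
    (\sum_i Arow A j.-1 0 i * tnth z i) + (- (sigma * t j))); last first.
  by apply/funext => z /=; rewrite /dev AZE.
apply: integrable_addr; last first.
  by apply: integrable_bounded_measurable; exact: bounded_measurable_cst.
apply: integrable_sumr => i _; apply: integrable_bounded_measurableM.
  exact: bounded_measurable_cst.
exact: inu.
Qed.

Lemma integrable_share_dev : nu.-integrable setT (EFin \o share_dev).
Proof.
rewrite [X in EFin \o X](_ : _ = fun z =>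
    \sum_(1 <= j < d.+1 | (1 <= j < d.+1)%N) share j z * dev j z); last first.
  by apply/funext => z; rewrite /share_dev big_nat.
apply: integrable_sumr => j jd; apply: integrable_bounded_measurableM => //.
  exact: bounded_share.
exact: integrable_dev.
Qed.

Lemma integrable_share2_dev : nu.-integrable setT (EFin \o share2_dev).
Proof.
rewrite [X in EFin \o X](_ : _ = fun z =>
    \sum_(1 <= i < d.+1 | (1 <= i < d.+1)%N)
      \sum_(i <= j < d.+1 | (i <= j < d.+1)%N)
        share i z * share j z * dev j z); last first.
  apply/funext => z; rewrite /share2_dev big_nat.
  by apply: eq_bigr => i _; rewrite big_nat.
apply: integrable_sumr => i /andP[i1 id].
apply: integrable_sumr => j /andP[ij jd].
apply: integrable_bounded_measurableM; last exact: integrable_dev.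
by apply: bounded_measurableM; apply: bounded_share; lia.
Qed.

End integrability.

Lemma measurable_psi (K : R) : measurable_fun setT (@psi R S0 r sigma T d A K).
Proof.
apply: measurable_funM => //; apply: measurable_funB => //.
apply: measurable_funB => //; apply: measurableT_comp => //.
exact: measurable_StA.
Qed.

Lemma StE j z : S_ j z = SA z * share j z.
Proof. by rewrite /share mulrC divfK// gt_eqF// StA_gt0. Qed.

End black_scholes_path.

(** * Conditional expectations of the Greeks *)

Section cond_exp_greeks.
Context {R : realType} {dsp : measure_display} {Omega : measurableType dsp}.
Variables (Q : probability Omega R).
Variables (S0 r sigma T K : R) (d : nat) (A : 'M[R]_(d.-1)).
Variables (W : R -> Omega -> R) (X1 : {RV Q >-> R})
  (Z : {RV Q >-> (d.-1).-tuple R}).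
Hypotheses (hS0 : 0 < S0) (hsigma : 0 < sigma) (hT : 0 < T) (hK : 0 < K).
Hypothesis hd : (2 <= d)%N.
Hypotheses (hX1 : normal_law Q 0 1 X1) (hX1Z : independent_pair Q X1 Z).
Hypothesis hZ : std_normal_vector Q Z.
Hypothesis hW1 : forall w, W (tgrid T d 1) w = Num.sqrt (tgrid T d 1) * X1 w.
Hypothesis hWA : forall w,
  \col_(i < d.-1) (W (tgrid T d i.+2) w - W (tgrid T d 1) w)
  = A *m vec_of_tuple (Z w).

Local Notation t j := (tgrid T d j).
Local Notation om := (omega r sigma).
Local Notation S_ := (@St R S0 r sigma T d A).
Local Notation SA := (@StA R S0 r sigma T d A).
Local Notation share := (share S0 r sigma T A).
Local Notation inv_avg := (inv_avg S0 r sigma T A).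
Local Notation share_dev := (share_dev S0 r sigma T A).
Local Notation share2 := (share2 S0 r sigma T A).
Local Notation share2_dev := (share2_dev S0 r sigma T A).
Local Notation tau := (Num.sqrt (t 1)).
Local Notation a := (sigma * tau).
Local Notation SAw w := (price_avg S0 r sigma T d W w).
Local Notation nu := (distribution Q Z).
Implicit Types (w : Omega) (z : (d.-1).-tuple R) (j : nat).

Let dR_gt0 : (0 : R) < d%:R. Proof. by rewrite ltr0n; case: d hd. Qed.
Let tau2 : tau ^+ 2 = t 1. Proof. by rewrite sqr_sqrtr// ltW// t1_gt0. Qed.
Let tau_gt0 : 0 < tau. Proof. by rewrite sqrtr_gt0 t1_gt0. Qed.
Let SA_gt0 z : 0 < SA z. Proof. exact: StA_gt0. Qed.
Let d_last : (1 <= d < d.+1)%N. Proof. by rewrite ltnSn andbT; case: d hd. Qed.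

Lemma brownian_grid j w : (1 <= j < d.+1)%N ->
  W (t j) w = tau * X1 w + AZ A j.-1 (Z w).
Proof.
case: j => [//|[_|k kd]].
  by rewrite hW1 AZE big1 ?addr0// => i _; rewrite mxE mul0r.
have kd' : (k < d.-1)%N by lia.
have := congr1 (fun M : 'cV[R]_(d.-1) => M (Ordinal kd') 0) (hWA w).
rewrite !mxE /= => /eqP; rewrite subr_eq addrC => /eqP ->.
rewrite hW1 AZE /Arow insubT; congr (_ + _).
by apply: eq_bigr => i _; rewrite !mxE.
Qed.

Lemma price_grid j w : (1 <= j < d.+1)%N ->
  price S0 r sigma W (t j) w = expR (om * t 1 + a * X1 w) * S_ j (Z w).
Proof.
move=> jd; rewrite /price /St brownian_grid// [RHS]mulrCA -expRD.
by congr (_ * expR _); ring.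
Qed.

Lemma price_avgE w : SAw w = expR (om * t 1 + a * X1 w) * SA (Z w).
Proof.
rewrite /price_avg /StA [RHS]mulrCA; congr (_ * _).
by rewrite mulr_sumr; apply: eq_big_nat => j jd; rewrite price_grid.
Qed.

Lemma price_avg_gt0 w : 0 < SAw w.
Proof. by rewrite price_avgE mulr_gt0// expR_gt0. Qed.

Lemma price_share j w : (1 <= j < d.+1)%N ->
  price S0 r sigma W (t j) w = SAw w * share j (Z w).
Proof. by move=> jd; rewrite price_grid// price_avgE -[RHS]mulrA -StE. Qed.

(** The only place where [X1] enters exponentially once [S_A] is factored out
    of the weights. *)
Lemma price_avgV w :
  (SAw w)^-1 = expR (- (om * t 1)) * expR (- a * X1 w) * inv_avg (Z w).
Proof.
rewrite price_avgE invfM -expRN -expRD; congr (expR _ * _); ring.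
Qed.

Lemma sum_share z : \sum_(1 <= j < d.+1) share j z = d%:R.
Proof. by rewrite -mulr_suml sum_St// mulfK// gt_eqF. Qed.

Lemma stat_yE w : stat_y S0 r sigma T d W w =
  T / d%:R * (SAw w * (tau * X1 w * d%:R + share_dev (Z w))).
Proof.
rewrite /stat_y; congr (_ * _).
rewrite -(sum_share (Z w)) mulr_sumr -big_split mulr_sumr.
apply: eq_big_nat => j jd; rewrite price_share// brownian_grid// /dev.
by rewrite /=; ring.
Qed.

Lemma stat_zE w : stat_z S0 r sigma T d W w =
  T ^+ 2 / d%:R ^+ 2 *
  (SAw w ^+ 2 * (tau * X1 w * share2 (Z w) + share2_dev (Z w))).
Proof.
rewrite /stat_z; congr (_ * _).
rewrite mulr_sumr -big_split mulr_sumr; apply: eq_big_nat => i /andP[i1 id].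
rewrite mulr_sumr -big_split mulr_sumr; apply: eq_big_nat => j /andP[ij jd].
rewrite !price_share ?brownian_grid//; [|lia..].
by rewrite /dev /=; ring.
Qed.

Lemma exercise_psi w : (K < SAw w) = (psi S0 r sigma T A K (Z w) < X1 w).
Proof.
rewrite /psi ltr_pdivrMr ?mulr_gt0// -ltr_ln ?posrE ?price_avg_gt0//.
rewrite price_avgE lnM ?posrE ?expR_gt0// expRK.
by apply/idP/idP => h; lra.
Qed.

(** The estimates in terms of [S_A], [X1] and functions of [Z]; expanding the
    weights then leaves only the powers [S_A^0], [S_A^-1] and [S_A^-2]. *)
Lemma theta_hat_tail (weight : R -> R -> R -> R -> R) w :
  theta_hat S0 r sigma T d W (binary_payoff K) weight w =
  if psi S0 r sigma T A K (Z w) < X1 w then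
    expR (- r * T) * weight (SAw w) (SAw w * share d (Z w))
      (T / d%:R * (SAw w * (tau * X1 w * d%:R + share_dev (Z w))))
      (T ^+ 2 / d%:R ^+ 2 *
        (SAw w ^+ 2 * (tau * X1 w * share2 (Z w) + share2_dev (Z w))))
  else 0.
Proof.
rewrite /theta_hat /binary_payoff stat_yE stat_zE exercise_psi price_share//.
by case: ifP => _; rewrite ?mulr1// mulr0 mul0r.
Qed.

Let integrable_coord (i : 'I_d.-1) :
  nu.-integrable setT (fun z => (tnth z i)%:E).
Proof.
apply: integrable_pushforward => //.
  by apply/measurable_EFinP; exact: measurable_tnth.
apply: (normal_law_integrable (Y := fun w => tnth (Z w) i)).
  by apply: (measurableT_comp (measurable_tnth i)).
by case: hZ => lawZ _; exact: lawZ.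
Qed.

(* the factor of [Phi2]: [exp (- om * t_1)] comes from [1 / S_A], and
   [exp (a^2 / 2)] from tilting by [exp (- a * X1)] *)
Let expR_discount :
  expR (- r * t 1 + sigma ^+ 2 * t 1) = expR (- (om * t 1)) * expR (a ^+ 2 / 2).
Proof. by rewrite -expRD exprMn tau2 /omega; congr expR; field. Qed.

Let sum_St_dev z :
  \sum_(1 <= j < d.+1) S_ j z * (AZ A j.-1 z - sigma * t j)
  = SA z * share_dev z.
Proof.
rewrite /share_dev mulr_sumr; apply: eq_bigr => j _.
by rewrite (StE r sigma T A hS0 hd) mulrA.
Qed.

Let sum_St2 z : \sum_(1 <= i < d.+1) \sum_(i <= j < d.+1) S_ i z * S_ j z
  = SA z ^+ 2 * share2 z.
Proof.
rewrite /share2 mulr_sumr; apply: eq_bigr => i _.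
rewrite mulr_sumr; apply: eq_bigr => j _.
by rewrite !(StE r sigma T A hS0 hd); ring.
Qed.

Let sum_St2_dev z :
  \sum_(1 <= i < d.+1) \sum_(i <= j < d.+1)
    S_ i z * S_ j z * (AZ A j.-1 z - sigma * t j) = SA z ^+ 2 * share2_dev z.
Proof.
rewrite /share2_dev mulr_sumr; apply: eq_bigr => i _.
rewrite mulr_sumr; apply: eq_bigr => j _.
by rewrite !(StE r sigma T A hS0 hd) /dev; ring.
Qed.

(** [c1] is the part of the weight proportional to [S0 / S_A]. *)
Lemma is_cond_exp_delta :
  is_cond_exp Q (g_sigma_algebra_preimage Z)
    (theta_hat S0 r sigma T d W (binary_payoff K) (weight_delta S0 r sigma T))
    (fun w => G_delta S0 r sigma T A K (Z w)).
Proof.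
pose k := expR (- r * T) * (2 / (S0 * sigma ^+ 2)).
pose c0 z := k * (share d z * T^-1 + - om).
pose c1 z := - (k * S0 / T * expR (- (om * t 1))) * inv_avg z.
have b0 : bounded_measurable c0.
  apply: bounded_measurableM; first exact: bounded_measurable_cst.
  apply: bounded_measurableD; last exact: bounded_measurable_cst.
  apply: bounded_measurableM; last exact: bounded_measurable_cst.
  exact: bounded_share.
have b1 : bounded_measurable c1.
  apply: bounded_measurableM; first exact: bounded_measurable_cst.
  exact: bounded_inv_avg.
have bz : bounded_measurable (fun _ : (d.-1).-tuple R => 0 : R).
  exact: bounded_measurable_cst.
have := is_cond_exp_gaussian_tail a hX1 hX1Z (measurable_psi S0 r sigma T A K)
  (integrable_bounded_measurable nu b0) (integrable_bounded_measurable nu b1)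
  (integrable_bounded_measurable nu bz) (integrable_bounded_measurable nu bz)
  (integrable_bounded_measurable nu bz).
congr is_cond_exp; apply/funext => w /=; rewrite !mul0r !addr0.
- rewrite theta_hat_tail; case: ifP => // _.
  transitivity (c0 (Z w) - k * S0 / T * (SAw w)^-1).
    by rewrite price_avgV /c0 /c1; ring.
  rewrite /weight_delta /c0 /k; field.
  by rewrite !gt_eqF// price_avg_gt0.
- rewrite /G_delta /Phi1 /Phi2.
  rewrite (_ : expR (- r * T - r * t 1 + sigma ^+ 2 * t 1) =
      expR (- r * T) * (expR (- (om * t 1)) * expR (a ^+ 2 / 2))); last first.
    by rewrite -expR_discount -expRD; congr expR; ring.
  rewrite !(StE r sigma T A hS0 hd) [- sigma * _]mulNr.
  rewrite /c0 /c1 /k /inv_avg; field.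
  by rewrite !gt_eqF.
Qed.

(** The square [(s - S0)^2] brings in [(S0 / S_A)^2], hence [c2] and
    [Phi3]. *)
Lemma is_cond_exp_gamma :
  is_cond_exp Q (g_sigma_algebra_preimage Z)
    (theta_hat S0 r sigma T d W (binary_payoff K) (weight_gamma S0 r sigma T))
    (fun w => G_gamma S0 r sigma T A K (Z w)).
Proof.
pose k := expR (- r * T) * (4 / (sigma ^+ 4 * S0 ^+ 2 * T ^+ 2)).
pose Ew := expR (- (om * t 1)).
pose c0 z := k * (share d z * share d z
  + (om * r * T ^+ 2 + - (2 * r * T) * share d z)).
pose c1 z := k * S0 * Ew * ((2 * om * T + - 2 * share d z) * inv_avg z).
pose c2 z := k * S0 ^+ 2 * Ew ^+ 2 * (inv_avg z * inv_avg z).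
have bcst c : bounded_measurable (fun _ : (d.-1).-tuple R => c : R).
  exact: bounded_measurable_cst.
have bshare : bounded_measurable (share d) by exact: bounded_share.
have binv : bounded_measurable inv_avg by exact: bounded_inv_avg.
have b0 : bounded_measurable c0.
  apply: bounded_measurableM => //; apply: bounded_measurableD.
    exact: bounded_measurableM.
  by apply: bounded_measurableD => //; exact: bounded_measurableM.
have b1 : bounded_measurable c1.
  apply: bounded_measurableM => //; apply: bounded_measurableM => //.
  by apply: bounded_measurableD => //; exact: bounded_measurableM.
have b2 : bounded_measurable c2.
  by apply: bounded_measurableM => //; exact: bounded_measurableM.
have := is_cond_exp_gaussian_tail a hX1 hX1Z (measurable_psi S0 r sigma T A K)
  (integrable_bounded_measurable nu b0) (integrable_bounded_measurable nu b1)
  (integrable_bounded_measurable nu b2)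
  (integrable_bounded_measurable nu (bcst 0))
  (integrable_bounded_measurable nu (bcst 0)).
congr is_cond_exp; apply/funext => w /=; rewrite !mul0r !addr0.
- rewrite theta_hat_tail; case: ifP => // _.
  transitivity (c0 (Z w)
      + k * S0 * (2 * om * T + - 2 * share d (Z w)) * (SAw w)^-1
      + k * S0 ^+ 2 * (SAw w)^-1 ^+ 2).
    rewrite price_avgV /c1 /c2 /Ew.
    rewrite (_ : expR (- (2 * a) * X1 w) = expR (- a * X1 w) ^+ 2); last first.
      by rewrite expr2 -expRD; congr expR; ring.
    by ring.
  rewrite /weight_gamma /c0 /k; field.
  by rewrite !gt_eqF// price_avg_gt0.
- rewrite /G_gamma /Phi1 /Phi2 /Phi3.
  rewrite (_ : expR (- 2 * r * t 1 + 3 * sigma ^+ 2 * t 1)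
    = Ew ^+ 2 * expR (2 * a ^+ 2)); last first.
    by rewrite [Ew ^+ 2]expr2 -!expRD exprMn tau2 /omega; congr expR; field.
  rewrite expR_discount -/Ew.
  rewrite !(StE r sigma T A hS0 hd) [- sigma * _]mulNr.
  rewrite (_ : - 2 * sigma * tau = - (2 * a)); last by ring.
  rewrite /c0 /c1 /c2 /k /inv_avg; field.
  by rewrite !gt_eqF.
Qed.

(** Here [y / S_A] and [z / S_A^2] are affine in [X1]: the coefficients [c3]
    and [c4] collect the linear terms, without and with a factor [S0 / S_A].
    The terms [share_dev] and [share2_dev] of [c0] and [c1] are unbounded, but
    integrable. *)
Lemma is_cond_exp_vega :
  is_cond_exp Q (g_sigma_algebra_preimage Z)
    (theta_hat S0 r sigma T d W (binary_payoff K) (weight_vega S0 r sigma T))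
    (fun w => G_vega S0 r sigma T A K (Z w)).
Proof.
pose k := expR (- r * T) * (2 / (sigma ^+ 2 * T)).
pose Ew := expR (- (om * t 1)).
pose net z := share d z + - ((r - sigma ^+ 2) * T).
pose c0 z := k / d%:R * (net z * share_dev z)
  + (- (k * sigma ^+ 2 * T / d%:R ^+ 2) * share2_dev z + - (k * sigma * T / 2)).
pose c1 z := - (k * S0 * Ew / d%:R) * (inv_avg z * share_dev z).
pose c3 z := k * tau * net z
  + - (k * sigma ^+ 2 * T * tau / d%:R ^+ 2) * share2 z.
pose c4 z := - (k * S0 * Ew * tau) * inv_avg z.
have bcst c : bounded_measurable (fun _ : (d.-1).-tuple R => c : R).
  exact: bounded_measurable_cst.
have bnet : bounded_measurable net.
  by apply: bounded_measurableD => //; exact: bounded_share.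
have binv : bounded_measurable inv_avg by exact: bounded_inv_avg.
have idev : nu.-integrable setT (EFin \o share_dev).
  exact: integrable_share_dev.
have idev2 : nu.-integrable setT (EFin \o share2_dev).
  exact: integrable_share2_dev.
have i0 : nu.-integrable setT (EFin \o c0).
  apply: integrable_addr.
    by do 2!apply: integrable_bounded_measurableM => //.
  apply: integrable_addr; first exact: integrable_bounded_measurableM.
  exact: integrable_bounded_measurable.
have i1 : nu.-integrable setT (EFin \o c1).
  by do 2!apply: integrable_bounded_measurableM => //.
have b3 : bounded_measurable c3.
  apply: bounded_measurableD; first exact: bounded_measurableM.
  by apply: bounded_measurableM => //; exact: bounded_share2.
have b4 : bounded_measurable c4 by exact: bounded_measurableM.
have := is_cond_exp_gaussian_tail a hX1 hX1Z (measurable_psi S0 r sigma T A K)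
  i0 i1 (integrable_bounded_measurable nu (bcst 0))
  (integrable_bounded_measurable nu b3) (integrable_bounded_measurable nu b4).
congr is_cond_exp; apply/funext => w /=; rewrite !mul0r !addr0.
- rewrite theta_hat_tail; case: ifP => // _.
  transitivity (c0 (Z w) + c3 (Z w) * X1 w
      - k * S0 * (tau * X1 w + share_dev (Z w) / d%:R) * (SAw w)^-1).
    rewrite price_avgV /c1 /c4 /Ew.
    by ring.
  rewrite /weight_vega /c0 /c3 /net /k; field.
  by rewrite !gt_eqF// price_avg_gt0.
- rewrite /G_vega /Phi1 /Phi2 sum_St_dev sum_St2 sum_St2_dev.
  rewrite (_ : expR (sigma ^+ 2 * t 1 / 2 - om * t 1)
    = Ew * expR (a ^+ 2 / 2)); last first.
    by rewrite -expRD exprMn tau2; congr expR; ring.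
  rewrite expR_discount -/Ew.
  rewrite !(StE r sigma T A hS0 hd) [- sigma * _]mulNr.
  rewrite !normal_pdf1E subr0 opprK.
  rewrite /c0 /c1 /c3 /c4 /net /k /inv_avg; field.
  by rewrite !gt_eqF// sqrtr_gt0 mulr_gt0// pi_gt0.
Qed.

End cond_exp_greeks.

Unset Implicit Arguments.

Theorem theorem6p2 (R : realType) (dsp : measure_display)
    (Omega : measurableType dsp) (Q : probability Omega R)
    (S0 r sigma T K : R) (d : nat) (W : R -> Omega -> R)
    (A : 'M[R]_(d.-1)) (X1 : {RV Q >-> R}) (Z : {RV Q >-> (d.-1).-tuple R})
    (hS0 : 0 < S0) (hr : 0 < r) (hsigma : 0 < sigma) (hT : 0 < T) (hK : 0 < K)
    (hd : (2 <= d)%N)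
    (hW : brownian_motion Q T W)
    (hA : A *m A^T = Sigma_mx T d)
    (hX1 : normal_law Q 0 1 X1)
    (hZ : std_normal_vector Q Z)
    (hX1Z : independent_pair Q X1 Z)
    (hW1 : forall w, W (tgrid T d 1) w = Num.sqrt (tgrid T d 1) * X1 w)
    (hWA : forall w,
      \col_(i < d.-1) (W (tgrid T d i.+2) w - W (tgrid T d 1) w)
      = A *m vec_of_tuple (Z w)) :
  let sigmaZ := g_sigma_algebra_preimage Z in
  let f := binary_payoff K in
  [/\ is_cond_exp Q sigmaZ
        (theta_hat S0 r sigma T d W f (weight_delta S0 r sigma T))
        (fun w => G_delta S0 r sigma T A K (Z w)),
      is_cond_exp Q sigmaZ
        (theta_hat S0 r sigma T d W f (weight_gamma S0 r sigma T))
        (fun w => G_gamma S0 r sigma T A K (Z w)) &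
      is_cond_exp Q sigmaZ
        (theta_hat S0 r sigma T d W f (weight_vega S0 r sigma T))
        (fun w => G_vega S0 r sigma T A K (Z w))].
Proof.
split.
- exact: (is_cond_exp_delta r hS0 hsigma hT hK hd hX1 hX1Z hW1 hWA).
- exact: (is_cond_exp_gamma r hS0 hsigma hT hK hd hX1 hX1Z hW1 hWA).
- exact: (is_cond_exp_vega r hS0 hsigma hT hK hd hX1 hX1Z hZ hW1 hWA).
Qed.
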